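(* Let $f(k)$ denote the minimum number of edges in an oriented $k$-graph with Property O. Then $f(k) \ge k!$ for every integer $k \ge 2$, and there exists $k_0$ such that $f(k) \le (k^2 \ln k)\, k!$ for all $k \ge k_0$.
   Context: Fix an integer $k \ge 2$ and a finite set $V$. An ordered $k$-set is a $k$-tuple $(x_1,\dots,x_k)$ of distinct elements of $V$. An oriented $k$-graph (oriented $k$-uniform hypergraph) is a pair $\mathcal{H}=(V,\mathcal{E})$ where $\mathcal{E}\subseteq V^k$ is a family of ordered $k$-sets such that no two members of $\mathcal{E}$ have the same underlying $k$-element set; its edges are the members of $\mathcal{E}$. Given a linear order $<$ on $V$, an ordered $k$-set $(x_1,\dots,x_k)$ is consistent with $<$ if $x_1<x_2<\dots<x_k$. An oriented $k$-graph $\mathcal{H}=(V,\mathcal{E})$ has Property O (the ordering property) if for every linear order $<$ of $V$ there exists some edge in $\mathcal{E}$ consistent with $<$. *)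

(* Defs.v *)
From mathcomp Require Import all_boot.
From mathcomp Require Import boolp.

Set Implicit Arguments.
Unset Strict Implicit.
Unset Printing Implicit Defensive.

Definition oriented_kgraph (k : nat) (V : finType) (E : {set k.-tuple V}) : Prop :=
  {in E, forall e : k.-tuple V, uniq e} /\
  {in E &, injective (fun e : k.-tuple V => [set x in e])}.

Definition strict_linear_order (V : finType) (lt : rel V) : Prop :=
  [/\ irreflexive lt, transitive lt & forall x y, x != y -> lt x y || lt y x].

Definition consistent (k : nat) (V : finType) (lt : rel V) (e : k.-tuple V) : Prop :=
  sorted lt e.

Definition propertyO (k : nat) (V : finType) (E : {set k.-tuple V}) : Prop :=
  forall lt : rel V, strict_linear_order lt -> exists2 e, e \in E & consistent lt e.

Definition propertyO_size (k m : nat) : Prop :=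
  exists (V : finType) (E : {set k.-tuple V}),
    [/\ oriented_kgraph E, propertyO E & #|E| = m].

(* The default value 0 is a junk value for the case where no oriented k-graph
   has Property O; a positive lower bound on [f k] therefore entails that the
   minimum exists, and in that case [f k] attains it. *)
Definition f (k : nat) : nat :=
  match pselect (exists m, `[< propertyO_size k m >]) with
  | left exm => ex_minn exm
  | right _ => 0
  end.

(* Main.v *)
Require Import Defs.
From mathcomp Require Import all_boot all_order all_algebra all_fingroup.
From mathcomp Require Import boolp reals sequences exp.
From mathcomp Require Import zify ring lra.

Set Implicit Arguments.
Unset Strict Implicit.
Unset Printing Implicit Defensive.
Import Order.TTheory GRing.Theory Num.Theory.
Local Open Scope ring_scope.

(** An ordered k-set is consistent with exactly a fraction 1/k! of all linear
    orders, so at least k! edges are needed to serve every order.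

    Conversely, run through m distinct k-subsets of an n-element set. Among the
    orders not yet served, some orientation of the current k-subset is consistent
    with at least a fraction 1/k!. At most n^n (1 - 1/k!)^m <= exp (n ln n - m/k!)
    orders remain at the end, hence none as soon as m > k! n ln n. This needs
    m <= C(n, k); n = C(k, 2) is large enough for that, and small enough to give
    m <= (k^2 ln k) k!. For small k any large n shows that f(k) is well defined. *)

(** * Linear orders coded by rank functions *)

Definition rank_lt (V : finType) (n : nat) (g : V -> 'I_n) : rel V := fun x y => (g x < g y)%N.

Lemma sorted_rank_lt (V : finType) (n : nat) (g : V -> 'I_n) (s : seq V) :
  sorted (rank_lt g) s = sorted ltn [seq val (g x) | x <- s].
Proof. by rewrite sorted_map. Qed.

Lemma rank_lt_order (V : finType) (n : nat) (g : V -> 'I_n) :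
  injective g -> strict_linear_order (rank_lt g).
Proof.
move=> g_inj; split=> [x|y x z|x y xy]; first exact: ltnn.
  exact: ltn_trans.
by rewrite -neq_ltn (inj_eq val_inj) (inj_eq g_inj).
Qed.

Lemma sorted_rank_lt_eq (V : finType) (n : nat) (g : V -> 'I_n) (s t : seq V) :
  sorted (rank_lt g) s -> sorted (rank_lt g) t -> perm_eq s t -> s = t.
Proof.
apply: (@sorted_eq _ (rank_lt g)) => [y x z|x y /andP[]]; first exact: ltn_trans.
by rewrite /rank_lt => /ltnW; rewrite leqNgt => /negP.
Qed.

(** * Lower bound by counting permutations *)

Definition perm_rank (V : finType) (s : {perm V}) (x : V) : 'I_#|V| := enum_rank (s x).

Lemma perm_rank_inj (V : finType) (s : {perm V}) : injective (perm_rank s).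
Proof. by move=> x y /enum_rank_inj /perm_inj. Qed.

(* Multiplying permutations consistent with [e] by permutations supported on [e]
   is injective, since an order admits only one consistent ordering of [e]. *)
Lemma card_consistent_perm (V : finType) (k : nat) (e : k.-tuple V) :
  uniq e ->
  (#|[set s : {perm V} | sorted (rank_lt (perm_rank s)) e]| * k`! <= #|{perm V}|)%N.
Proof.
move=> ue; set A := [set s | _].
have <- : #|[set x in e]| = k by rewrite cardsE (card_uniqP ue) size_tuple.
rewrite -card_perm -[X in (_ * X)%N]cardsE -cardsX.
rewrite -(@card_in_imset _ _ (fun p : {perm V} * {perm V} => (p.2 * p.1)%g)); first exact: max_card.
move=> [s1 g1] [s2 g2]; rewrite !inE /= => /andP[s1A g1e] /andP[s2A g2e] eq12.
have eqg : g1 = g2.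
  have g12e : perm_on [set x in e] (g2^-1 * g1)%g.
    by rewrite perm_onM // perm_onV.
  have eqs : s2 = ((g2^-1 * g1) * s1)%g by rewrite -mulgA eq12 mulKg.
  set g := (g2^-1 * g1)%g in g12e eqs.
  (* Consistency of [e] with [s2] says that [map g e] is consistent with [s1]. Both lists enumerate
     the same set, so they coincide. *)
  have ge : map g e = e :> seq V.
    apply: (@sorted_rank_lt_eq _ _ (perm_rank s1)) => //.
      rewrite sorted_map; apply: sub_sorted s2A => x y.
      by rewrite /rank_lt /perm_rank /= eqs !permM.
    apply: uniq_perm => //; first by rewrite map_inj_uniq //; exact: perm_inj.
    apply: (uniq_min_size _ _ _).2 => //; first by rewrite map_inj_uniq //; exact: perm_inj.
      move=> _ /mapP[x xe ->].
      by have := perm_closed x g12e; rewrite !inE xe.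
    by rewrite size_map.
  have g1E : g = 1%g.
    apply/permP => x; rewrite perm1.
    have [xe|xe] := boolP (x \in tval e); last by apply: (out_perm g12e); rewrite inE.
    by have /eq_in_map/(_ x xe) : map g e = map id e by rewrite map_id.
  by rewrite -(mulKVg g2 g1) -/g g1E mulg1.
by move: eq12; rewrite eqg => /mulgI ->.
Qed.

(** Union bound, by double counting. It serves both for orders covered by edges and for orders
    covered by the k! orderings of one set. *)
Lemma card_le_sum_cover (T : finType) (I : Type) (L : {set T}) (r : seq I) (P : I -> pred T) :
  {in L, forall x, has (P^~ x) r} ->
  (#|L| <= \sum_(i <- r) #|[set x in L | P i x]|)%N.
Proof.
move=> cov.
have -> : (\sum_(i <- r) #|[set x in L | P i x]| = \sum_(x in L) count (P^~ x) r)%N.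
  under eq_bigr do rewrite -sum1_card.
  under [RHS]eq_bigr do rewrite -sum1_count.
  rewrite (exchange_big_dep (mem L)) /=; last by move=> i x _; rewrite inE => /andP[].
  by apply: eq_bigr => x xL; apply: eq_bigl => i; rewrite inE xL.
by rewrite -sum1_card; apply: leq_sum => x /cov; rewrite -has_count.
Qed.

Lemma propertyO_size_ge (k m : nat) : propertyO_size k m -> (k`! <= m)%N.
Proof.
move=> [V [E [[Eu _] EO <-]]].
have N_gt0 : (0 < #|{perm V}|)%N by apply/card_gt0P; exists 1%g.
rewrite -(leq_pmul2r N_gt0).
have /(leq_mul (leqnn k`!)) : (#|[set: {perm V}]| <= \sum_(e <- enum E)
    #|[set s in [set: {perm V}] | sorted (rank_lt (perm_rank s)) e]|)%N.
  apply: (card_le_sum_cover (P := fun e s => sorted (rank_lt (perm_rank s)) (tval e))).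
  move=> s _; have [e eE es] := EO _ (rank_lt_order (@perm_rank_inj _ s)).
  by apply/hasP; exists e; rewrite // mem_enum.
rewrite cardsT => /leq_trans; apply.
rewrite big_enum mulnC big_distrl /= -sum_nat_const; apply: leq_sum => e eE.
apply: leq_trans (card_consistent_perm (Eu _ eE)); rewrite leq_mul2r; apply/orP; right.
by apply/subset_leq_card/subsetP => s; rewrite !inE.
Qed.

(** * Greedy orientation and the counting criterion *)

(** Pigeonhole: each injective [g] sorts [S] into one of its k! orderings, so some ordering is
    reached by at least the average share of [L]. *)
Lemma popular_ordering (V : finType) (n k : nat) (L : {set {ffun V -> 'I_n}}) (S : {set V}) :
  {in L, forall g : {ffun V -> 'I_n}, injective g} -> #|S| = k ->
  exists e : k.-tuple V, [/\ uniq e, [set x in e] = S &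
    (#|L| <= k`! * #|[set g in L | sorted (rank_lt g) e]|)%N].
Proof.
move=> Linj cS.
pose c (t : seq V) := #|[set g : {ffun V -> 'I_n} in L | sorted (rank_lt g) t]|.
pose P := permutations (enum S).
have sP : size P = k`! by rewrite size_permutations ?enum_uniq // -cardE cS.
have covL : (#|L| <= \sum_(t <- P) c t)%N.
  apply: (card_le_sum_cover (P := fun t (g : {ffun V -> 'I_n}) => sorted (rank_lt g) t)) => g gL.
  apply/hasP; exists (sort (fun x y => g x <= g y)%N (enum S)).
    by rewrite mem_permutations perm_sort.
  rewrite sorted_rank_lt ltn_sorted_uniq_leq; apply/andP; split.
    rewrite map_inj_uniq ?sort_uniq ?enum_uniq //.
    by move=> x y /ord_inj /(Linj _ gL).
  by rewrite sorted_map; apply: sort_sorted => x y; apply: leq_total.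
have /hasP[t tP tL] : has (fun t => #|L| <= k`! * c t)%N P.
  rewrite -[has _ _]negbK -all_predC; apply/negP => /allP small.
  have : (\sum_(t <- P) (k`! * c t).+1 <= \sum_(t <- P) #|L|)%N.
    rewrite big_seq [leqRHS]big_seq; apply: leq_sum => t /small /=.
    by rewrite -ltnNge.
  under eq_bigr do rewrite -addn1.
  rewrite big_split /= !big_const_seq !count_predT !iter_addn_0 -big_distrr /= sP mul1n.
  move=> /leq_trans/(_ (leq_mul covL (leqnn _))).
  by rewrite mulnC -[leqRHS]addn0 leq_add2l leqNgt fact_gt0.
have /[!mem_permutations] pt := tP.
have st : size t == k by rewrite (perm_size pt) -cardE cS.
exists (Tuple st); split=> //=; first by rewrite (perm_uniq pt) enum_uniq.
by apply/setP => x; rewrite inE /= (perm_mem pt) mem_enum.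
Qed.

(* [L] collects the orders still to be served; they are coded by arbitrary rank
   functions, so that there are at most [n ^ n] of them on [n] points. *)
Lemma greedy_orientation (V : finType) (n k : nat) (L : {set {ffun V -> 'I_n}})
    (Ss : seq {set V}) :
  {in L, forall g : {ffun V -> 'I_n}, injective g} ->
  all (fun S : {set V} => #|S| == k) Ss ->
  exists es : seq (k.-tuple V),
    [/\ [seq [set x in e] | e : k.-tuple V <- es] = Ss,
        all (fun e : k.-tuple V => uniq e) es &
        (#|[set g in L | ~~ has (fun e : k.-tuple V => sorted (rank_lt g) e) es]|
           * k`! ^ size Ss <= #|L| * k`!.-1 ^ size Ss)%N].
Proof.
elim: Ss L => [|S Ss IH] L Linj /=.
  exists [::]; split=> //=; rewrite !expn0 !muln1.
  by apply/subset_leq_card/subsetP => g; rewrite inE => /andP[].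
move=> /andP[/eqP cS cSs].
have [e [ue eS eL]] := popular_ordering Linj cS.
pose L1 := [set g in L | ~~ sorted (rank_lt g) e].
have L1inj : {in L1, forall g : {ffun V -> 'I_n}, injective g}.
  by move=> g; rewrite inE => /andP[gL _]; apply: Linj.
have [es [esS ues esL]] := IH L1 L1inj cSs.
exists (e :: es); split; rewrite /= ?eS ?esS ?ue //.
have -> : [set g in L | ~~ (sorted (rank_lt g) e ||
      has (fun e : k.-tuple V => sorted (rank_lt g) e) es)] =
    [set g in L1 | ~~ has (fun e : k.-tuple V => sorted (rank_lt g) e) es].
  by apply/setP => g; rewrite !inE negb_or andbA.
(* The chosen orientation serves at least a fraction 1/k! of [L], so at most (k! - 1)/k! of it
   survives the round. *)
have cL1 : (k`! * #|L1| <= k`!.-1 * #|L|)%N.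
  have := cardsID [set g : {ffun V -> 'I_n} | sorted (rank_lt g) e] L.
  have -> : L :&: [set g : {ffun V -> 'I_n} | sorted (rank_lt g) e] =
    [set g in L | sorted (rank_lt g) e] by apply/setP => g; rewrite !inE.
  have -> : L :\: [set g : {ffun V -> 'I_n} | sorted (rank_lt g) e] = L1.
    by apply/setP => g; rewrite !inE andbC.
  move=> /(congr1 (muln k`!)) /esym; rewrite mulnDr -subn1 mulnBl mul1n => ->.
  by rewrite -addnBAC // leq_addl.
rewrite !expnS mulnCA.
apply: leq_trans (leq_mul (leqnn _) esL) _.
by rewrite !mulnA leq_mul2r [(#|L| * _)%N]mulnC cL1 orbT.
Qed.

(** The rank of a point is the number of points below it. The implication from ranks to [lt] is what
    carries sortedness by rank over to consistency with [lt]. *)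
Lemma linear_order_rank (V : finType) (lt : rel V) :
  strict_linear_order lt ->
  exists2 g : {ffun V -> 'I_#|V|}, injective g & forall x y, (g x < g y)%N -> lt x y.
Proof.
move=> [irr tr tot].
have rkP x : (#|[set y | lt y x]| < #|V|)%N.
  rewrite -cardsT; apply: proper_card; apply/properP; split; first exact/subsetP.
  by exists x; rewrite !inE // irr.
have mono x y : lt x y -> (#|[set z | lt z x]| < #|[set z | lt z y]|)%N.
  move=> xy; apply: proper_card; apply/properP; split.
    by apply/subsetP => z; rewrite !inE => /tr; apply.
  by exists x; rewrite !inE // irr.
exists [ffun x => Ordinal (rkP x)].
  move=> x y; rewrite !ffunE => -[] eq_rk; apply/eqP/contraT => /tot /orP[] /mono.
    by rewrite eq_rk ltnn.
  by rewrite eq_rk ltnn.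
move=> x y; rewrite !ffunE /= => gxy.
have /tot/orP[//|/mono] : x != y by apply: contraTneq gxy => ->; rewrite ltnn.
by rewrite ltnNge (ltnW gxy).
Qed.

Lemma propertyO_size_count (n k m : nat) :
  (m <= 'C(n, k))%N -> (n ^ n * k`!.-1 ^ m < k`! ^ m)%N -> propertyO_size k m.
Proof.
move=> m_le count; pose V := 'I_n.
pose Ss := take m (enum [set A : {set V} | #|A| == k]).
have sSs : size Ss = m.
  by rewrite size_takel // -cardE card_draws card_ord.
have cSs : all (fun S : {set V} => #|S| == k) Ss.
  by apply/allP => S /mem_take; rewrite mem_enum inE.
pose L := [set g : {ffun V -> 'I_n} | injectiveb g].
have Linj : {in L, forall g : {ffun V -> 'I_n}, injective g}.
  by move=> g; rewrite inE => /injectiveP.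
have [es [esS ues esL]] := greedy_orientation Linj cSs.
(* Distinctness of the underlying sets yields both the condition on oriented k-graphs and the exact
   number of edges. *)
have ues' : uniq [seq [set x in e] | e : k.-tuple V <- es].
  by rewrite esS take_uniq // enum_uniq.
exists V, [set e in es]; split.
- split=> [e|e1 e2]; rewrite !inE; first exact: (allP ues).
  move=> e1s e2s /= eq12;
  rewrite -(nth_index e1 e1s) -(nth_index e1 e2s); congr nth.
  apply/eqP; rewrite -(nth_uniq set0 _ _ ues') ?size_map ?index_mem //.
  by rewrite !(nth_map e1) ?index_mem // !nth_index //; apply/eqP.
- move=> lt /linear_order_rank; rewrite card_ord => -[g g_inj g_lt].
  have gL : g \in L by rewrite inE; apply/injectiveP.
  suff /hasP[e e_es /= eg] : has (fun e : k.-tuple V => sorted (rank_lt g) e) es.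
    by exists e; rewrite ?inE //; apply: sub_sorted eg => x y; apply: g_lt.
  (* A single unserved order makes the surviving count at least 1, hence k!^m <= n^n (k! - 1)^m. *)
  apply: contraLR count => g_bad; rewrite -leqNgt.
  apply: leq_trans (_ : #|L| * k`!.-1 ^ m <= _)%N; last first.
    rewrite leq_mul2r; apply/orP; right.
    by apply: leq_trans (max_card _) _; rewrite card_ffun !card_ord.
  rewrite -sSs; apply: leq_trans esL; rewrite leq_pmull //.
  by apply/card_gt0P; exists g; rewrite inE gL.
- rewrite cardsE (card_uniqP (map_uniq ues')) -sSs -esS size_map //.
Qed.

Lemma propertyO_size_ln (R : realType) (n k m : nat) :
  (0 < n)%N -> (m <= 'C(n, k))%N -> (k`!)%:R * (n%:R * ln (n%:R : R)) < m%:R ->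
  propertyO_size k m.
Proof.
move=> n_gt0 m_le m_gt; apply: propertyO_size_count m_le _.
set q := k`! in m_gt *; have q_gt0 : (0 < q)%N by apply: fact_gt0.
have q_gt0' : (0 : R) < q%:R by rewrite ltr0n.
rewrite -(ltr_nat R) natrM !natrX -subn1 natrB //.
have -> : n%:R ^+ n = expR (n%:R * ln n%:R) :> R.
  by rewrite expRM_natl lnK // posrE ltr0n.
have -> : (q%:R - 1%:R) ^+ m = (1 - q%:R^-1) ^+ m * q%:R ^+ m :> R.
  by rewrite -exprMn mulrBl mul1r mulVf ?gt_eqF.
rewrite mulrA gtr_pMl ?exprn_gt0 //.
have q1 : 0 <= 1 - q%:R^-1 :> R by rewrite subr_ge0 invf_le1 // ler1n.
(* This is 1 + y <= exp y at y = -1/k!, raised to the power m. *)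
have le1 : (1 - q%:R^-1) ^+ m <= expR (m%:R * - q%:R^-1) :> R.
  by rewrite expRM_natl lerXn2r // ?nnegrE ?expR_ge0 // expR_ge1Dx.
apply: le_lt_trans (ler_wpM2l (expR_ge0 _) le1) _.
rewrite -expRD -[ltRHS]expR0 ltr_expR mulrN subr_lt0.
by rewrite ltr_pdivlMr // mulrC.
Qed.

(** * Attained sizes and the minimum [f] *)

(** The attained size [m] excludes the default value 0 of [f k]. *)
Lemma f_ge (k m : nat) : propertyO_size k m -> (k`! <= f k)%N.
Proof.
move=> km; rewrite /f; case: pselect => [exm|nex].
  by case: ex_minnP => j /asboolP /propertyO_size_ge.
by case: nex; exists m; apply/asboolP.
Qed.

Lemma f_le (k m : nat) : propertyO_size k m -> (f k <= m)%N.
Proof.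
move=> km; rewrite /f; case: pselect => [exm|nex] //.
by case: ex_minnP => j _; apply; apply/asboolP.
Qed.

(** * Estimates for the binomial coefficient C(C(k, 2), k) *)

(** Squared form of k! <= ((k + 1)/2)^k: the factors i + 1 and k - i sum to k + 1, and AM-GM applies
    to each such pair. *)
Lemma fact_AGM (k : nat) : (4 ^ k * (k`! * k`!) <= (k.+1 ^ 2) ^ k)%N.
Proof.
have fE : k`! = (\prod_(i < k) i.+1)%N by rewrite fact_prod big_add1 big_mkord.
have fE' : k`! = (\prod_(i < k) (k - i))%N.
  by rewrite fE (reindex_inj rev_ord_inj) /=; apply: eq_bigr => i _; rewrite subnSK.
have expE m : (m ^ k = \prod_(i < k) m)%N by rewrite prod_nat_const card_ord.
rewrite {1}fE fE' !expE -!big_split /=; apply: leq_prod => i _.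
have := (nat_AGM2 i.+1 (k - i)).1.
by have -> : (i.+1 + (k - i) = k.+1)%N by have := ltn_ord i; lia.
Qed.

Lemma ffact_lower (n k : nat) : ((n.+1 - k) ^ k <= n ^_ k)%N.
Proof.
rewrite ffact_prod -[leqLHS](_ : \prod_(i < k) (n.+1 - k) = _)%N; last first.
  by rewrite prod_nat_const card_ord.
by apply: leq_prod => i _; have := ltn_ord i; lia.
Qed.

(** The exponential gain (3/2)^k that pays for the factor k^3 in the next bound. The induction step
    rests on 2 (k + 1)^3 <= 3 k^3. *)
Lemma cube_le_exp32 (k : nat) : (25 <= k)%N -> (2 ^ k * k ^ 3 <= 3 ^ k)%N.
Proof.
elim: k => // k IH; rewrite leq_eqVlt => /predU1P[<-|k25].
  by rewrite -lez_nat; lia.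
have {}IH := IH k25; rewrite !expnS in IH *.
suff : (2 * (k.+1 * (k.+1 * k.+1)) <= 3 * (k * (k * k)))%N by nia.
nia.
Qed.

Lemma double_bin2 (k : nat) : (2 * 'C(k, 2) = k * k.-1)%N.
Proof. by rewrite mulnC -[2%N]/(2`!) bin_ffact ffactnS ffactn1. Qed.

Lemma bin_bin2_lower (k : nat) : (25 <= k)%N -> (k`! * k ^ 3 <= 'C('C(k, 2), k))%N.
Proof.
move=> k25; set n := 'C(k, 2).
have nE : (2 * n = k * k.-1)%N := double_bin2 k.
(* Each factor of the falling factorial is at least 3/8 (k + 1)^2, whereas [fact_AGM] spends only
   1/4 (k + 1)^2 per factor; the quotient is 3/2. *)
have base : (3 * k.+1 ^ 2 <= 8 * (n.+1 - k))%N by nia.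
rewrite -(leq_pmul2r (fact_gt0 k)) bin_ffact -(@leq_pmul2l (8 ^ k)) ?expn_gt0 //.
apply: leq_trans (leq_mul (leqnn _) (ffact_lower _ _)); rewrite -expnMn.
apply: leq_trans (_ : (3 * k.+1 ^ 2) ^ k <= _)%N; last by rewrite leq_exp2r //; lia.
have -> : (8 ^ k * (k`! * k ^ 3 * k`!) = 2 ^ k * k ^ 3 * (4 ^ k * (k`! * k`!)))%N.
  by rewrite -[8%N]/(2 * 4)%N expnMn; ring.
by rewrite [leqRHS]expnMn; apply: leq_mul (cube_le_exp32 k25) (fact_AGM k).
Qed.

(** * Existence for every k >= 2, and the two bounds on [f] *)

Lemma propertyO_size_exists (R : realType) (k : nat) :
  (2 <= k)%N -> exists m, propertyO_size k m.
Proof.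
(* All k-subsets are oriented. With n = t^2, n ln n < 2 t^3, while k! C(n, k) >= (n + 1 - k)^2 >=
   t^4/4; the choice of [t] makes 2 q^2 t^3 equal to t^4/4. *)
move=> k2; set q := k`!; pose t := (8 * q ^ 2)%N; pose n := (t ^ 2)%N.
have q0 : (0 < q)%N by apply: fact_gt0.
have kq : (k <= q)%N by rewrite /q; case: (k) k2 => // j _; rewrite factS leq_pmulr ?fact_gt0.
have kt : (k <= t)%N by rewrite /t; nia.
have n0 : (0 < n)%N by rewrite expn_gt0; lia.
exists 'C(n, k); apply: (@propertyO_size_ln R n) => //.
have lnkn : n%:R * ln (n%:R : R) < 2 * t%:R ^+ 3.
  have t0 : (0 : R) < t%:R by rewrite ltr0n; lia.
  rewrite natrX lnXn // -[ln _ *+ 2]mulr_natl; have := ln_sublinear t0.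
  set l := ln _; move=> lt; rewrite [X in _ < X](_ : _ = t%:R ^+ 2 * (2 * t%:R)); last by ring.
  by rewrite ltr_pM2l ?exprn_gt0 // ltr_pM2l.
apply: (@lt_le_trans _ _ (q%:R * (2 * t%:R ^+ 3))).
  by rewrite ltr_pM2l // ltr0n.
rewrite -natrX -!natrM ler_nat -(leq_pmul2r q0) bin_ffact.
apply: leq_trans (ffact_lower _ _).
apply: leq_trans (_ : (n.+1 - k) ^ 2 <= _)%N; last by rewrite leq_pexp2l //; nia.
have half : (n <= 2 * (n.+1 - k))%N by rewrite /n; nia.
rewrite -(@leq_pmul2l 4) //.
apply: leq_trans (_ : n ^ 2 <= _)%N; last first.
  by rewrite (_ : 4 = 2 ^ 2)%N // -expnMn leq_exp2r.
have -> : (4 * (q * (2 * t ^ 3) * q) = 8 * q ^ 2 * t ^ 3)%N by ring.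
by rewrite -/t -expnS -expnM.
Qed.

Theorem theorem1 (R : realType) :
  (forall k : nat, (2 <= k)%N -> (k`! <= f k)%N) /\
  (exists k0 : nat, forall k : nat, (k0 <= k)%N ->
     (f k)%:R <= (k%:R ^+ 2 * ln (k%:R : R)) * (k`!)%:R).
Proof.
split=> [k /(propertyO_size_exists R)[m]|]; first exact: f_ge.
(* [n = k (k - 1) / 2] makes [n ln n <= k^2 ln k - k ln k], which leaves room for
   rounding up the number of edges. *)
exists 25%N => k k25; set n := 'C(k, 2).
have nE : (2 * n = k * k.-1)%N := double_bin2 k.
have n0 : (0 < n)%N by nia.
have k0 : (0 : R) < k%:R by rewrite ltr0n; lia.
(* From ln (1/k) <= 1/k - 1 follows k ln k >= k - 1. *)
have l1 : 1 <= ln (k%:R : R) * k%:R.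
  have kV : -1 < (k%:R : R)^-1 - 1 by rewrite ltrBDl subrr invr_gt0.
  have := le_ln1Dx kV; rewrite subrKC lnV ?posrE // lerNl opprB => lnk.
  have := ler_wpM2r (ltW k0) lnk; rewrite mulrBl mul1r mulVf ?gt_eqF //.
  apply: le_trans; rewrite lerBrDr (_ : 1 + 1 = 2%:R) // ler_nat; lia.
have lk := ltW (ln_sublinear k0).
pose x : R := (k`!)%:R * (n%:R * ln (n%:R : R)).
have q1 : (1 : R) <= (k`!)%:R by rewrite ler1n fact_gt0.
have lnn0 : 0 <= ln (n%:R : R) by rewrite ln_ge0 // ler1n.
have lnkn : ln (n%:R : R) <= 2 * ln (k%:R : R).
  rewrite mulr_natl -lnXn // ler_ln ?posrE ?exprn_gt0 // ?ltr0n //.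
  by rewrite -natrX ler_nat; nia.
have x1 : x + 1 <= (k%:R ^+ 2 * ln (k%:R : R)) * (k`!)%:R.
  have nR : 2 * n%:R = k%:R * (k%:R - 1) :> R.
    by rewrite -natrM nE natrM -subn1 natrB //; lia.
  have ln2 := ler_wpM2l (ler0n R n) lnkn.
  have qlk : 1 <= (k`!)%:R * (ln (k%:R : R) * k%:R) by exact: mulr_ege1.
  have := ler_wpM2l (ler0n R k`!) ln2; rewrite -/x.
  have -> : n%:R * (2 * ln (k%:R : R)) = k%:R * (k%:R - 1) * ln k%:R by rewrite -nR; ring.
  lra.
(* The number of edges is floor x + 1: strictly above [x], as the criterion demands, and at most x +
   1. *)
have m_gt : x < (Num.truncn x).+1%:R by apply: truncnS_gt.
have m_le : (Num.truncn x).+1%:R <= x + 1 by rewrite -natr1 lerD2r truncn_le !mulr_ge0.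
apply: le_trans (le_trans m_le x1); rewrite ler_nat; apply/f_le.
apply: (@propertyO_size_ln R n) => //.
(* Since ln k <= k, the bound k^2 ln k k! is at most k^3 k!, so there are enough k-subsets. *)
apply: leq_trans (bin_bin2_lower k25).
rewrite -(ler_nat R); apply: le_trans m_le (le_trans x1 _).
rewrite natrM mulrC ler_pM2l ?(lt_le_trans ltr01) // natrX [leRHS]exprSr.
by rewrite ler_wpM2l // exprn_ge0 // ltW.
Qed.
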